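(* Let $\kappa\in\overline S$ and $\gamma,\mu\in\mathcal D^\sigma$ with $\kappa\notin\tau(\gamma)$ and $\kappa\in\tau(\mu)$. Then $$\widehat P(\gamma,\mu)=v^{-\ell(\kappa)+\mathrm{def}_\gamma(\kappa)}\sum_{\gamma'\,:\,\gamma'\xrightarrow{\kappa}\gamma}\epsilon(\gamma',\gamma)\,\widehat P(\gamma',\mu).$$
   Context: Setting (Lusztig–Vogan). $G$ is a complex connected reductive group, $\theta$ a Cartan involution, $K=G^\theta$, $H\subset B$ a Cartan and a Borel subgroup, $(W,S)$ the Weyl group with its simple reflections. $\sigma$ is an automorphism of $G$ commuting with $\theta$, preserving $(B,H)$ and inducing an involution $\sigma$ of $(W,S)$. $\mathcal D$ is the finite set of irreducible $K$-equivariant local systems on $K$-orbits on $G/B$, with its length $\ell$, cross action $w\times\gamma$ of $W$, and (possibly multivalued) Cayley transforms $\gamma^\alpha$ (noncompact imaginary $\alpha$), $\gamma_\alpha$ (real parity $\alpha$). $\mathcal D^\sigma$ is the set of $\sigma$-fixed elements. $\overline S$ is the set of $\sigma$-orbits on $S$. For $\kappa=\{s_\alpha\}$ or $\{s_\alpha,s_\beta\}$ ($\beta=\sigma\alpha$), $w_\kappa$ is the longest element of the group generated by $\kappa$ and $\ell(\kappa)=\ell(w_\kappa)$: it is $1$ if $\sigma\alpha=\alpha$, $2$ if $\alpha\neq\beta$ are orthogonal, $3$ if $\langle\alpha,\beta^\vee\rangle=-1$. Types. For $\gamma\in\mathcal D^\sigma$, $\kappa\in\overline S$ the type $t_\gamma(\kappa)$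 (leading digit $k=\ell(\kappa)$) is one of: Ascents ($\kappa\notin\tau(\gamma)$): 1C+, 1i1, 1i2f, 1i2s, 1rn; 2C+, 2Ci, 2i11, 2i12, 2i22, 2rn; 3C+, 3Ci, 3i, 3rn. Descents ($\kappa\in\tau(\gamma)$): 1C-, 1r1f, 1r1s, 1r2, 1ic; 2C-, 2Cr, 2r11, 2r21, 2r22, 2ic; 3C-, 3Cr, 3r, 3ic. $\tau(\gamma)$ is the set of descents. Here C$\pm$: $\alpha$ (and $\beta$) complex, $\pm\theta\alpha>0$, $\theta\alpha\ne\pm\beta$ if $k>1$; Ci: $\theta\alpha=\beta$; Cr: $\theta\alpha=-\beta$; ic: compact imaginary; rn: real not satisfying the parity condition; the remaining i- (resp. r-) types: noncompact imaginary (resp. real parity). 1i1: type 1; 1i2f, 1i2s: type 2 with $\sigma$ fixing, resp. switching, the two values of $\gamma^\alpha$; 1r1f, 1r1s: type 1 with $\sigma$ fixing, resp. switching, the two values of $\gamma_\alpha$; 1r2: type 2; 2i11, 2i12, 2i22: $(\gamma^\alpha)^\beta$ has $1,2,4$ values; 2r22, 2r21, 2r11: $(\gamma_\alpha)_\beta$ has $1,2,4$ values. The $\kappa$-Cayley transforms are: $\gamma^\kappa=\gamma^\alpha$, $\gamma_\kappa=\gamma_\alpha$ for 1i1,1i2f,1r1f,1r2; $\gamma^\kappa=(\gamma^\alpha)^\beta$, $\gamma_\kappa=(\gamma_\alpha)_\beta$ for 2i11,2i12,2r22,2r21, and the two $\sigma$-fixed elements of these sets for 2i22, 2r11; $s_\alpha\times\gamma=s_\beta\times\gamma$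 for 2Ci ($\gamma^\kappa$) and 2Cr ($\gamma_\kappa$); $\gamma^\kappa=(s_\alpha\times\gamma)^\beta\cap(s_\beta\times\gamma)^\alpha$ for 3Ci and $\gamma_\kappa=(s_\alpha\times\gamma)_\beta\cap(s_\beta\times\gamma)_\alpha$ for 3Cr; $\gamma^\kappa=s_\alpha\times\gamma^\beta=s_\beta\times\gamma^\alpha$ for 3i and $\gamma_\kappa=s_\alpha\times\gamma_\beta=s_\beta\times\gamma_\alpha$ for 3r. Two values are denoted $\gamma^\kappa_1,\gamma^\kappa_2$ or $\gamma_\kappa^1,\gamma_\kappa^2$. Up- and down-transforms are mutually inverse relations, matching 1i1/1r1f, 1i2f/1r2, 2Ci/2Cr, 2i11/2r11, 2i12/2r21, 2i22/2r22, 3Ci/3Cr, 3i/3r; $w_\kappa\times$ exchanges $k$C+ and $k$C-. Module. $u=v^2$. $M$ is the Lusztig–Vogan module, free over $\mathbb Z[v,v^{-1}]$ with basis $a_\gamma$ ($\gamma\in\mathcal D^\sigma$), for the Hecke algebra generated by the $T_{w_\kappa}$ with $(T_{w_\kappa}+1)(T_{w_\kappa}-u^{\ell(\kappa)})=0$. Standing assumption: extensions of parameters have been chosen so that, with $k=\ell(\kappa)$, $T_{w_\kappa}a_\gamma$ equals $k$C+: $a_{w_\kappa\times\gamma}$; $k$C-: $(u^k-1)a_\gamma+u^ka_{w_\kappa\times\gamma}$; 1i1, 2i11: $a_{w_\kappa\times\gamma}+a_{\gamma^\kappa}$; 1i2f, 2i22: $a_\gamma+a_{\gamma^\kappa_1}+a_{\gamma^\kappa_2}$;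 2i12: $a_\gamma+\sum_{\gamma'\xrightarrow{\kappa}\gamma}\epsilon(\gamma',\gamma)a_{\gamma'}$; 2Ci, 3Ci, 3i: $ua_\gamma+(u+1)a_{\gamma^\kappa}$; 1i2s, 1rn, 2rn, 3rn: $-a_\gamma$; 1ic, 2ic, 3ic, 1r1s: $u^ka_\gamma$; 1r1f, 2r11: $(u^k-2)a_\gamma+(u^k-1)(a_{\gamma_\kappa^1}+a_{\gamma_\kappa^2})$; 1r2, 2r22: $(u^k-1)a_\gamma-a_{w_\kappa\times\gamma}+(u^k-1)a_{\gamma_\kappa}$; 2r21: $(u^2-2)a_\gamma+(u^2-1)\sum_{\gamma\xrightarrow{\kappa}\gamma'}\epsilon(\gamma,\gamma')a_{\gamma'}$; 2Cr, 3Cr, 3r: $(u^k-u-1)a_\gamma+(u^k-u)a_{\gamma_\kappa}$. Arrows: $\gamma\xrightarrow{\kappa}\lambda$ means $\kappa\in\tau(\gamma)$, $\kappa\notin\tau(\lambda)$ and $a_\lambda$ appears in $T_{w_\kappa}a_\gamma$. Signs: for $\gamma\xrightarrow{\kappa}\lambda$, $\epsilon(\gamma,\lambda)=1$ unless $t_\gamma(\kappa)=$ 2r21; in that case $\gamma$ belongs to an ordered pair $(\gamma_1,\gamma_2)$ with $\{\gamma_1,\gamma_2\}=\{\gamma,s_\alpha\times\gamma\}$, $\lambda$ to an ordered pair $(\lambda_1,\lambda_2)$ of 2i12 parameters whose underlying set is the common Cayley transform of $\gamma_1,\gamma_2$ (chosen orderings), and $\epsilon(\gamma_i,\lambda_j)=-1$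 if $i=j=2$ and $1$ otherwise. Defect: $\mathrm{def}_\gamma(\kappa)=1$ if $t_\gamma(\kappa)\in\{$2Ci, 3Ci, 3i, 2Cr, 3Cr, 3r$\}$, else $0$; if $\gamma\xrightarrow{\kappa}\lambda$ then $\ell(\gamma)-\ell(\lambda)=\ell(\kappa)-\mathrm{def}_\gamma(\kappa)$ and $\mathrm{def}_\lambda(\kappa)=\mathrm{def}_\gamma(\kappa)$. Normalizations: $\hat a_\gamma=v^{-\ell(\gamma)}a_\gamma$, $\widehat T_\kappa=v^{-\ell(\kappa)}(T_{w_\kappa}+1)$. Canonical basis (Lusztig–Vogan, recalled). $\mathcal D^\sigma$ has a partial order $\le$ with $\gamma<\delta\Rightarrow\ell(\gamma)<\ell(\delta)$. $M$ has a canonical additive involution $\mathbf D$, semilinear for $v\mapsto v^{-1}$, commuting with every $\widehat T_\kappa$, and a unique basis $\widehat C_\delta=\sum_\gamma\widehat P(\gamma,\delta)\hat a_\gamma$ ($\delta\in\mathcal D^\sigma$) with $\mathbf D\widehat C_\delta=\widehat C_\delta$, $\widehat P(\gamma,\delta)\neq0\Rightarrow\gamma\le\delta$, $\widehat P(\delta,\delta)=1$, $\widehat P(\gamma,\delta)\in v^{-1}\mathbb Z[v^{-1}]$ for $\gamma\ne\delta$; moreover $\widehat P(\gamma,\delta)=v^{\ell(\gamma)-\ell(\delta)}P(\gamma,\delta)(v^2)$ with $P(\gamma,\delta)$ an integer polynomial. Also $\kappa\in\tau(\lambda)$ iff $\widehat T_\kappa\widehat C_\lambda=(v^{\ell(\kappa)}+v^{-\ell(\kappa)})\widehat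 C_\lambda$. *)

(* Defs.v *)
From HB Require Import structures.
From mathcomp Require Import all_boot all_order all_fingroup all_algebra.
From mathcomp Require Import boolp.
Set Implicit Arguments. Unset Strict Implicit. Unset Printing Implicit Defensive.
Import GRing.Theory.
Local Open Scope ring_scope.

(* Z[v,v^-1], realized inside the fraction field of Z[v] as the fractions some
   v^n-multiple of which is a polynomial. *)
Definition laurent_pred : {pred {fraction {poly int}}} :=
  fun x => `[< exists n (p : {poly int}), x * (tofrac 'X) ^+ n = tofrac p >].

Lemma fX_neq0 : tofrac ('X : {poly int}) != 0.
Proof. by rewrite tofrac_eq0 polyX_eq0. Qed.

Fact laurent_subring : subring_closed laurent_pred.
Proof.
split.
- by apply/asboolP; exists 0%N, 1; rewrite expr0 mulr1 tofrac1.
- move=> x y /asboolP[m [p Ex]] /asboolP[n [q Ey]]; apply/asboolP.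
  exists (m + n)%N, (p * 'X^n - q * 'X^m).
  rewrite exprD tofracB !tofracM -Ex -Ey !tofracXn mulrBl !mulrA.
  by congr (_ - _); rewrite mulrAC.
- move=> x y /asboolP[m [p Ex]] /asboolP[n [q Ey]]; apply/asboolP.
  by exists (m + n)%N, (p * q); rewrite exprD tofracM -Ex -Ey mulrACA.
Qed.

HB.instance Definition _ :=
  GRing.isSubringClosed.Build _ laurent_pred laurent_subring.

Record laurent := Laurent { lval : {fraction {poly int}};
                            _ : lval \in laurent_pred }.
HB.instance Definition _ := [isSub for lval].
HB.instance Definition _ := [Choice of laurent by <:].
HB.instance Definition _ := [SubChoice_isSubComNzRing of laurent by <:].

Fact vX_subproof (z : int) : (tofrac ('X : {poly int})) ^ z \in laurent_pred.
Proof.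
apply/asboolP; case: z => n.
  by exists 0%N, 'X^n; rewrite expr0 mulr1 tofracXn.
by exists n.+1, 1; rewrite tofrac1 NegzE -exprnN mulVf // expf_neq0 // fX_neq0.
Qed.

(* v ^ z *)
Definition vX (z : int) : laurent := Laurent (vX_subproof z).

(* p(x), for a polynomial p with integer coefficients *)
Definition ev (x : laurent) (p : {poly int}) : laurent := (map_poly intr p).[x].

Lemma vXD y z : vX (y + z) = vX y * vX z.
Proof. by apply: val_inj; rewrite rmorphM /= expfzDr ?fX_neq0. Qed.

Lemma vX0 : vX 0 = 1. Proof. exact: val_inj. Qed.

Lemma vXn (z : int) n : vX z ^+ n = vX (z * n%:Z).
Proof. by apply: val_inj; rewrite rmorphXn /= exprnP exprz_exp. Qed.

Fact ev_is_zmod x : zmod_morphism (ev x).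
Proof. by move=> p q; rewrite /ev rmorphB hornerD hornerN. Qed.
Fact ev_is_monoid x : monoid_morphism (ev x).
Proof. by split=> [|p q]; rewrite /ev ?rmorph1 ?hornerC // rmorphM hornerM. Qed.
HB.instance Definition _ x := GRing.isZmodMorphism.Build _ _ (ev x) (ev_is_zmod x).
HB.instance Definition _ x := GRing.isMonoidMorphism.Build _ _ (ev x) (ev_is_monoid x).

Lemma evX x : ev x 'X = x. Proof. by rewrite /ev map_polyX hornerX. Qed.

Lemma ev_val p : val (ev (vX 1) p) = tofrac p.
Proof.
elim/poly_ind: p => [|p c IHp]; first by rewrite !rmorph0.
have -> : ev (vX 1) (p * 'X + c%:P) = ev (vX 1) p * vX 1 + ev (vX 1) c%:P.
  by rewrite rmorphD rmorphM /= evX.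
rewrite tofracD tofracM (rmorphD val) (rmorphM val).
rewrite -[X in X * _]/(val (ev (vX 1) p)) IHp /= expr1z; congr (_ + _).
have -> : ev (vX 1) c%:P = c%:~R by rewrite /ev map_polyC hornerC.
by rewrite -[lval _]/(val _) (rmorph_int val) -[in RHS](intz c) !rmorph_int.
Qed.

Lemma laurentP (x : laurent) : exists np : nat * {poly int},
  x * vX 1 ^+ np.1 == ev (vX 1) np.2.
Proof.
case: x => x xP; have /asboolP[n [p Ex]] := xP; exists (n, p); apply/eqP/val_inj.
by rewrite rmorphM rmorphXn /= ev_val expr1z.
Qed.

(* The ring involution v |-> v^-1; see bar_vX. *)
Definition bar (x : laurent) : laurent :=
  let np := xchoose (laurentP x) in vX np.1%:Z * ev (vX (-1)) np.2.

Lemma barE x n p : x * vX 1 ^+ n = ev (vX 1) p -> bar x = vX n%:Z * ev (vX (-1)) p.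
Proof.
move=> Ex; rewrite /bar; have := xchooseP (laurentP x).
case: (xchoose _) => m q /= /eqP Eq.
have E : p * 'X^m = q * 'X^n.
  apply/eqP; rewrite -tofrac_eq -!ev_val !rmorphM /= -Ex -Eq !rmorphXn /= evX.
  by rewrite mulrAC.
have {}E : ev (vX (-1)) p * vX (- m%:Z) = ev (vX (-1)) q * vX (- n%:Z).
  by have := congr1 (ev (vX (-1))) E; rewrite !rmorphM !rmorphXn /= !evX !vXn !mulN1r.
have vK k z : z = vX k%:Z * (z * vX (- k%:Z)).
  by rewrite mulrCA -vXD subrr vX0 mulr1.
by rewrite [ev _ q](vK n) -E [in RHS](vK m (ev _ p)) mulrCA.
Qed.

Fact bar_is_zmod : zmod_morphism bar.
Proof.
move=> x y; case: (laurentP x) => [[m p] /= /eqP Ex]; case: (laurentP y) => [[n q] /= /eqP Ey].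
rewrite (barE Ex) (barE Ey) (@barE _ (m + n) (p * 'X^n - q * 'X^m)); last first.
  rewrite rmorphB !rmorphM !rmorphXn /= -Ex -Ey evX exprD mulrBl !mulrA.
  by congr (_ - _); rewrite mulrAC.
rewrite rmorphB !rmorphM !rmorphXn /= evX !vXn !mulN1r PoszD vXD mulrBr.
congr (_ - _).
  by rewrite mulrACA -vXD subrr vX0 mulr1.
by rewrite [vX m%:Z * _]mulrC mulrACA -vXD subrr vX0 mulr1.
Qed.
Fact bar_is_monoid : monoid_morphism bar.
Proof.
split=> [|x y]; first by rewrite (@barE _ 0 1) ?mulr1 ?expr0 ?rmorph1 ?mulr1 // vX0.
case: (laurentP x) => [[m p] /= /eqP Ex]; case: (laurentP y) => [[n q] /= /eqP Ey].
rewrite (barE Ex) (barE Ey) (@barE _ (m + n) (p * q)).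
  by rewrite rmorphM PoszD vXD mulrACA.
by rewrite rmorphM /= -Ex -Ey exprD mulrACA.
Qed.
HB.instance Definition _ := GRing.isZmodMorphism.Build _ _ bar bar_is_zmod.
HB.instance Definition _ := GRing.isMonoidMorphism.Build _ _ bar bar_is_monoid.

Lemma bar_vX z : bar (vX z) = vX (- z).
Proof.
case: z => n.
  rewrite (@barE _ 0 'X^n) ?rmorphXn /= ?evX ?vXn ?mul1r ?mulN1r ?vX0 ?mul1r //.
  by rewrite mulr1.
rewrite (@barE _ n.+1 1) ?rmorph1 ?mulr1 ?NegzE ?opprK //.
by rewrite vXn mul1r -vXD addNr vX0.
Qed.

Local Notation u := (vX 1 ^+ 2).

Record basedRootDatum := BasedRootDatum {
  rk : nat;
  rdroot : finType;
  wt : rdroot -> 'rV[int]_rk;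
  cowt : rdroot -> 'rV[int]_rk;
  refl : rdroot -> {perm rdroot};
  simples : {set rdroot};
  posroots : {set rdroot};
  pairing (a b : rdroot) : int := (wt a *m (cowt b)^T) 0 0;
  (* - a is the image of a under its own reflection *)
  negr (a : rdroot) : rdroot := refl a a;
  wt_inj : injective wt;
  pairing_diag : forall a, pairing a a = 2;
  refl_wt : forall a b, wt (refl a b) = wt b - pairing b a *: wt a;
  refl_cowt : forall a b, cowt (refl a b) = cowt b - pairing a b *: cowt a;
  root_reduced : forall a b (m : int), wt b = m *: wt a -> b = a \/ b = negr a;
  simple_indep : forall c : rdroot -> int,
    \sum_(a in simples) c a *: wt a = 0 -> {in simples, forall a, c a = 0};
  simple_pos : simples \subset posroots;
  pos_neg : forall a, (negr a \in posroots) = (a \notin posroots);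
  pos_comb : forall a, a \in posroots ->
    exists c : rdroot -> nat, wt a = \sum_(b in simples) (c b)%:Z *: wt b
}.

(* The simple reflections S are indexed by the simple roots. In {perm rdroot R}
   the product s * t acts by s first, so it stands for the element ts of W. *)
Definition weyl (R : basedRootDatum) : {group {perm rdroot R}} :=
  <<[set refl a | a in simples R]>>%G.

Definition root_automorphism (R : basedRootDatum) (f : {perm rdroot R}) : Prop :=
  (forall a b, f (refl a b) = refl (f a) (f b)) /\
  (forall a b, pairing (f a) (f b) = pairing a b).

Record diagramTwist (R : basedRootDatum) := DiagramTwist {
  sigma :> {perm rdroot R};
  sigmaK : involutive sigma;
  sigma_aut : root_automorphism sigma;
  sigma_simple : {in simples R, forall a, sigma a \in simples R}
}.

(* Least n such that w is a product of n simple reflections. *)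
Definition wlen (R : basedRootDatum) (w : {perm rdroot R}) : nat :=
  find (fun n => w \in ([set refl a | a in simples R] ^+ n)%g) (iota 0 #|weyl R|).

Section Orbits.
Variables (R : basedRootDatum) (sg : diagramTwist R).

Definition Sbar : {set {set rdroot R}} := [set [set a; sg a] | a in simples R].

Definition wk (k : {set rdroot R}) : {perm rdroot R} :=
  [arg max_(w > 1%g in <<[set refl a | a in k]>>%g) wlen w]%N.

Definition ell (k : {set rdroot R}) : nat := wlen (wk k).

End Orbits.

(* The data attached to (G, theta, sigma), through their standard properties.
   par is the set D of irreducible K-equivariant local systems on the K-orbits on G/B,
   with the structure that it carries. Roots are those of (B, H); through the
   usual identification with the Cartan attached to g, theta g is the action
   of the Cartan involution on them. cross g w is w x g: since products in
   {perm rdroot R} compose from left to right, the left action of W is an action in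
   the sense of the library. noncompact g and parity g are meaningful on
   imaginary, resp. real, roots only; up g a = g^a and dn g a = g_a are the sets
   of values of the Cayley transforms, empty where these are not defined, and
   constrained for simple a only. *)
Record lvParam (R : basedRootDatum) (sg : diagramTwist R) := LVParam {
  par : finType;
  len : par -> nat;
  sigD : {perm par};
  theta : par -> {perm rdroot R};
  cross : action (weyl R) par;
  noncompact : par -> pred (rdroot R);
  parity : par -> pred (rdroot R);
  up : par -> rdroot R -> {set par};
  dn : par -> rdroot R -> {set par};

  theta_aut : forall g, root_automorphism (theta g);
  thetaK : forall g, involutive (theta g);
  theta_inner : forall g h, ((theta g)^-1 * theta h)%g \in weyl R;

  theta_cross : forall g w, w \in weyl R -> theta (cross g w) = (theta g ^ w)%g;
  noncompact_cross : forall g w a, w \in weyl R -> theta g a = a ->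
    noncompact (cross g w) (w a) = noncompact g a;
  parity_cross : forall g w a, w \in weyl R -> theta g a = negr a ->
    parity (cross g w) (w a) = parity g a;
  len_cross : forall g a, a \in simples R ->
    theta g a != a -> theta g a \in posroots R ->
    len (cross g (refl a)) = (len g).+1;

  up_dom : forall g a, a \in simples R ->
    (up g a != set0) = (theta g a == a) && noncompact g a;
  dn_dom : forall g a, a \in simples R ->
    (dn g a != set0) = (theta g a == negr a) && parity g a;
  up_dn : forall g h a, a \in simples R -> (h \in up g a) = (g \in dn h a);
  up_theta : forall g h a, a \in simples R -> h \in up g a ->
    theta h = (theta g * refl a)%g;
  up_len : forall g h a, a \in simples R -> h \in up g a -> len h = (len g).+1;
  up_card : forall g a, a \in simples R -> (#|up g a| <= 2)%N;
  dn_card : forall g a, a \in simples R -> (#|dn g a| <= 2)%N;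
  up_type1 : forall g h a, a \in simples R -> up g a = [set h] ->
    [/\ cross g (refl a) != g, cross h (refl a) = h
      & dn h a = [set g; cross g (refl a)]];
  dn_type2 : forall g h a, a \in simples R -> dn h a = [set g] ->
    [/\ cross h (refl a) != h, cross g (refl a) = g
      & up g a = [set h; cross h (refl a)]];

  sigD_len : forall g, len (sigD g) = len g;
  sigD_theta : forall g, theta (sigD g) = (theta g ^ sg)%g;
  sigD_cross : forall g w, w \in weyl R ->
    cross (sigD g) (w ^ sg)%g = sigD (cross g w);
  sigD_noncompact : forall g a, theta g a = a ->
    noncompact (sigD g) (sg a) = noncompact g a;
  sigD_parity : forall g a, theta g a = negr a ->
    parity (sigD g) (sg a) = parity g a;
  sigD_up : forall g a, a \in simples R ->
    up (sigD g) (sg a) = sigD @: up g a;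
  sigD_dn : forall g a, a \in simples R ->
    dn (sigD g) (sg a) = sigD @: dn g a
}.

Inductive lvtype :=
  | T1Cp | T1i1 | T1i2f | T1i2s | T1rn
  | T2Cp | T2Ci | T2i11 | T2i12 | T2i22 | T2rn
  | T3Cp | T3Ci | T3i | T3rn
  | T1Cm | T1r1f | T1r1s | T1r2 | T1ic
  | T2Cm | T2Cr | T2r11 | T2r21 | T2r22 | T2ic
  | T3Cm | T3Cr | T3r | T3ic.

Definition is_descent (t : lvtype) : bool :=
  match t with
  | T1Cp | T1i1 | T1i2f | T1i2s | T1rn
  | T2Cp | T2Ci | T2i11 | T2i12 | T2i22 | T2rn
  | T3Cp | T3Ci | T3i | T3rn => false
  | _ => true
  end.

(* Types of g and of h when h is a value of g^k. For ell k = 3 only the classes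
   {3Ci, 3i} and {3Cr, 3r} are related; in fact theta (s_a x g^b) is theta g
   followed by s_(a+b) for 3i, of type 3Cr, and likewise 3Ci goes to 3r. *)
Definition matched (t t' : lvtype) : bool :=
  match t, t' with
  | T1i1, T1r1f | T1i2f, T1r2 | T2Ci, T2Cr
  | T2i11, T2r11 | T2i12, T2r21 | T2i22, T2r22
  | T3Ci, (T3Cr | T3r) | T3i, (T3Cr | T3r) => true
  | _, _ => false
  end.

(* Number of values of the kappa-Cayley transform (upwards for ascents,
   downwards for descents). *)
Definition nvalues (t : lvtype) : nat :=
  match t with
  | T1i1 | T2Ci | T2i11 | T3Ci | T3i | T1r2 | T2Cr | T2r22 | T3Cr | T3r => 1
  | T1i2f | T2i12 | T2i22 | T1r1f | T2r11 | T2r21 => 2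
  | _ => 0
  end.

Definition tdefect (t : lvtype) : nat :=
  match t with
  | T2Ci | T3Ci | T3i | T2Cr | T3Cr | T3r => 1
  | _ => 0
  end.

Section Types.
Variables (R : basedRootDatum) (sg : diagramTwist R) (L : lvParam sg).
Implicit Types (a b : rdroot R) (k : {set rdroot R}).

Definition fixpar : {set par L} := [set g | sigD L g == g].

(* D^sigma *)
Definition Dsig : finType := {g : par L | g \in fixpar}.

Definition up2 (g : par L) a b : {set par L} := \bigcup_(h in up g a) up h b.
Definition dn2 (g : par L) a b : {set par L} := \bigcup_(h in dn g a) dn h b.

(* b = s(a) is a itself, orthogonal to a, or (last case) <a, b^vee> = -1; these
   are the cases ell k = 1, 2, 3 for k = {a, b}. *)
Definition type_at (g : par L) a : lvtype :=
  let b := sg a in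
  let ta := theta g a in
  if b == a then
    if ta == a then
      if noncompact g a then
        if #|up g a| == 1%N then T1i1
        else if up g a \subset fixpar then T1i2f else T1i2s
      else T1ic
    else if ta == negr a then
      if parity g a then
        if #|dn g a| == 1%N then T1r2
        else if dn g a \subset fixpar then T1r1f else T1r1s
      else T1rn
    else if ta \in posroots R then T1Cp else T1Cm
  else if pairing a b == 0 then
    if ta == a then
      if noncompact g a then
        if #|up2 g a b| == 1%N then T2i11
        else if #|up2 g a b| == 2%N then T2i12 else T2i22
      else T2ic
    else if ta == negr a then
      if parity g a then
        if #|dn2 g a b| == 1%N then T2r22
        else if #|dn2 g a b| == 2%N then T2r21 else T2r11
      else T2rn
    else if ta == b then T2Ci
    else if ta == negr b then T2Cr
    else if ta \in posroots R then T2Cp else T2Cm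
  else
    if ta == a then if noncompact g a then T3i else T3ic
    else if ta == negr a then if parity g a then T3r else T3rn
    else if ta == b then T3Ci
    else if ta == negr b then T3Cr
    else if ta \in posroots R then T3Cp else T3Cm.

Definition up_at (g : par L) a : {set par L} :=
  let b := sg a in
  match type_at g a with
  | T1i1 | T1i2f => up g a
  | T2i11 | T2i12 | T2i22 => up2 g a b
  | T2Ci => [set cross L g (refl a)]
  | T3Ci => up (cross L g (refl a)) b :&: up (cross L g (refl b)) a
  | T3i => [set cross L h (refl a) | h in up g b]
  | _ => set0
  end.

Definition dn_at (g : par L) a : {set par L} :=
  let b := sg a in
  match type_at g a with
  | T1r1f | T1r2 => dn g a
  | T2r11 | T2r21 | T2r22 => dn2 g a b
  | T2Cr => [set cross L g (refl a)]
  | T3Cr => dn (cross L g (refl a)) b :&: dn (cross L g (refl b)) a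
  | T3r => [set cross L h (refl a) | h in dn g b]
  | _ => set0
  end.

(* t_g(k), g^k and g_k, computed with a chosen root a of k; for g in D^sigma
   they do not depend on this choice (see kappa_wd). The dummy values are only
   taken for empty k. *)
Definition ltype (g : Dsig) k : lvtype :=
  oapp (type_at (val g)) T1rn [pick a in k].
Definition kup (g : Dsig) k : {set Dsig} :=
  [set h | val h \in oapp (up_at (val g)) set0 [pick a in k]].
Definition kdn (g : Dsig) k : {set Dsig} :=
  [set h | val h \in oapp (dn_at (val g)) set0 [pick a in k]].

Definition tau (g : Dsig) : {set {set rdroot R}} :=
  [set k in Sbar sg | is_descent (ltype g k)].

Definition defect (g : Dsig) k : nat := tdefect (ltype g k).

(* w_k x g *)
Definition kcross (g : Dsig) k : par L := cross L (val g) (wk k).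

(* The known behaviour of types and of kappa-Cayley transforms on D^sigma. *)
Record cayleyFacts : Prop := CayleyFacts {
  up2_card : forall (g : Dsig) a, a \in simples R -> sg a != a ->
    pairing a (sg a) = 0 -> theta (val g) a = a -> noncompact (val g) a ->
    #|up2 (val g) a (sg a)| \in [:: 1; 2; 4]%N;
  dn2_card : forall (g : Dsig) a, a \in simples R -> sg a != a ->
    pairing a (sg a) = 0 -> theta (val g) a = negr a -> parity (val g) a ->
    #|dn2 (val g) a (sg a)| \in [:: 1; 2; 4]%N;
  kappa_wd : forall (g : Dsig) a, a \in simples R ->
    [/\ type_at (val g) (sg a) = type_at (val g) a,
        up_at (val g) (sg a) = up_at (val g) a
      & dn_at (val g) (sg a) = dn_at (val g) a];
  kup_card : forall (g : Dsig) k, k \in Sbar sg -> k \notin tau g ->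
    #|kup g k| = nvalues (ltype g k);
  kdn_card : forall (g : Dsig) k, k \in Sbar sg -> k \in tau g ->
    #|kdn g k| = nvalues (ltype g k);
  kup_kdn : forall (g h : Dsig) k, k \in Sbar sg -> (h \in kup g k) = (g \in kdn h k);
  kup_type : forall (g h : Dsig) k, k \in Sbar sg -> h \in kup g k ->
    matched (ltype g k) (ltype h k);
  kcross_Cp : forall (g : Dsig) k, k \in Sbar sg ->
    match ltype g k with
    | T1Cp => exists2 h : Dsig, val h = kcross g k & ltype h k = T1Cm
    | T2Cp => exists2 h : Dsig, val h = kcross g k & ltype h k = T2Cm
    | T3Cp => exists2 h : Dsig, val h = kcross g k & ltype h k = T3Cm
    | T1Cm => exists2 h : Dsig, val h = kcross g k & ltype h k = T1Cp
    | T2Cm => exists2 h : Dsig, val h = kcross g k & ltype h k = T2Cp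
    | T3Cm => exists2 h : Dsig, val h = kcross g k & ltype h k = T3Cp
    | _ => True
    end
}.

(* The free module on the a_g, g in D^sigma. *)
Definition lvmod := {ffun Dsig -> laurent^o}.

(* a_g; the value is 0 when g is not fixed by sigma *)
Definition avec (g : par L) : lvmod := [ffun h => (val h == g)%:R].

(* second g says that g is the second element of its ordered pair. *)
Definition eps (second : {set rdroot R} -> pred Dsig) k (g h : Dsig) : laurent :=
  match ltype g k with
  | T2r21 => (-1) ^+ (second k g && second k h)
  | _ => 1
  end.

(* In types 2i12 and 2r21 the sums over arrows are taken over the values of the
   Cayley transform: arrows are defined below in terms of the operators. *)
Definition hecke_formula (second : {set rdroot R} -> pred Dsig) k (g : Dsig)
    : lvmod :=
  let q : laurent := u ^+ ell k in
  let sumC (X : {set Dsig}) : lvmod := \sum_(h in X) avec (val h) in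
  match ltype g k with
  | T1Cp | T2Cp | T3Cp => avec (kcross g k)
  | T1Cm | T2Cm | T3Cm => (q - 1) *: avec (val g) + q *: avec (kcross g k)
  | T1i1 | T2i11 => avec (kcross g k) + sumC (kup g k)
  | T1i2f | T2i22 => avec (val g) + sumC (kup g k)
  | T2i12 => avec (val g) + \sum_(h in kup g k) eps second k h g *: avec (val h)
  | T2Ci | T3Ci | T3i => u *: avec (val g) + (u + 1) *: sumC (kup g k)
  | T1i2s | T1rn | T2rn | T3rn => - avec (val g)
  | T1ic | T2ic | T3ic | T1r1s => q *: avec (val g)
  | T1r1f | T2r11 => (q - 2) *: avec (val g) + (q - 1) *: sumC (kdn g k)
  | T1r2 | T2r22 =>
      (q - 1) *: avec (val g) - avec (kcross g k) + (q - 1) *: sumC (kdn g k)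
  | T2r21 => (q - 2) *: avec (val g)
             + (q - 1) *: \sum_(h in kdn g k) eps second k g h *: avec (val h)
  | T2Cr | T3Cr | T3r =>
      (q - u - 1) *: avec (val g) + (q - u) *: sumC (kdn g k)
  end.

Definition arrow (T : {set rdroot R} -> lvmod -> lvmod) k (g h : Dsig) : bool :=
  [&& k \in tau g, k \notin tau h & T k (avec (val g)) h != 0].

(* x y x y ... with m factors, applied to z *)
Fixpoint alternate (m : nat) (x y : lvmod -> lvmod) (z : lvmod) : lvmod :=
  if m is m'.+1 then x (alternate m' y x z) else z.

(* The Hecke action for a choice of extensions and of orderings of the pairs. *)
Record lvModule := LVModule {
  Tk : {set rdroot R} -> {linear lvmod -> lvmod};
  second : {set rdroot R} -> pred Dsig;

  Tk_quadratic : forall k x, k \in Sbar sg ->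
    Tk k (Tk k x - u ^+ ell k *: x) + (Tk k x - u ^+ ell k *: x) = 0;
  Tk_braid : forall k k' x, k \in Sbar sg -> k' \in Sbar sg ->
    let m := #[(wk k * wk k')%g]%g in
    alternate m (Tk k) (Tk k') x = alternate m (Tk k') (Tk k) x;

  (* the pair of g is {g, s_a x g}, and both elements have the same transform *)
  second_dn : forall k (g : Dsig) a, k \in Sbar sg -> ltype g k = T2r21 -> a \in k ->
    exists h : Dsig, [/\ val h = cross L (val g) (refl a), ltype h k = T2r21,
                  kdn h k = kdn g k & second k h = ~~ second k g];
  second_up : forall k (g h h' : Dsig), k \in Sbar sg -> ltype g k = T2r21 ->
    h \in kdn g k -> h' \in kdn g k -> h != h' ->
    second k h' = ~~ second k h;

  TkE : forall k (g : Dsig), k \in Sbar sg ->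
    Tk k (avec (val g)) = hecke_formula second k g;

  arrow_len : forall k (g h : Dsig), k \in Sbar sg -> arrow Tk k g h ->
    (len (val g))%:Z - (len (val h))%:Z = (ell k)%:Z - (defect g k)%:Z;
  arrow_defect : forall k (g h : Dsig), k \in Sbar sg -> arrow Tk k g h ->
    defect h k = defect g k
}.

Definition ahat (g : Dsig) : lvmod :=
  vX (- (len (val g))%:Z) *: avec (val g).

Definition That (N : lvModule) k (x : lvmod) : lvmod :=
  vX (- (ell k)%:Z) *: (Tk N k x + x).

Definition Chat (P : Dsig -> Dsig -> laurent) (d : Dsig) : lvmod :=
  \sum_(g : Dsig) P g d *: ahat g.

Record canonicalBasis (N : lvModule) := CanonicalBasis {
  lep : rel Dsig;
  Dual : {additive lvmod -> lvmod};
  Phat : Dsig -> Dsig -> laurent;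

  lep_refl : reflexive lep;
  lep_anti : antisymmetric lep;
  lep_trans : transitive lep;
  lep_len : forall g d, lep g d -> g != d -> (len (val g) < len (val d))%N;

  Dual_semilinear : forall (c : laurent) x, Dual (c *: x) = bar c *: Dual x;
  DualK : involutive Dual;
  Dual_That : forall k x, k \in Sbar sg -> Dual (That N k x) = That N k (Dual x);

  Dual_Chat : forall d, Dual (Chat Phat d) = Chat Phat d;
  Phat_le : forall g d, Phat g d != 0 -> lep g d;
  Phat_diag : forall d, Phat d d = 1;
  Phat_off : forall g d, g != d ->
    exists p : {poly int}, Phat g d = vX (-1) * ev (vX (-1)) p;
  Phat_poly : forall g d, exists p : {poly int},
    Phat g d = vX ((len (val g))%:Z - (len (val d))%:Z) * ev u p;
  tau_Chat : forall k d, k \in Sbar sg ->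
    (k \in tau d) <->
    That N k (Chat Phat d) = (vX (ell k)%:Z + vX (- (ell k)%:Z)) *: Chat Phat d
}.

End Types.

(* Main.v *)
Require Import Defs.
From HB Require Import structures.
From mathcomp Require Import all_boot all_order all_fingroup all_algebra.
From mathcomp Require Import zify ring.
Local Open Scope ring_scope.
Import Order.TTheory GRing.Theory Num.Theory.

(** Write T for T_{w_kappa}, q = u ^ l(kappa), and C for the canonical basis
    element of mu, with C = \sum_h c_h a_h, so that
    c_h = v ^ (- l(h)) Phat(h, mu). Since kappa is a descent of mu, C satisfies
    T C = q C. The length of an arrow g' -> g is l(kappa) - def_g(kappa), so the
    powers of v in the claim only undo the rescaling from c_h to Phat(h, mu):
    what has to be proved is

      c_g = \sum_(g' -> g) eps(g', g) c_g'   for every ascent g.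

    This holds for the coordinates of any vector C with T C = q C (lemma
    eigen_descent). Compare the coefficients of a_g on both sides. The
    coefficient of a_g in T a_h, for g an ascent, is given by Tk_coef: there
    is a nonzero weight r, depending on the type of g only, with

      coefficient in T a_g  = q - r,
      coefficient in T a_g' = r eps(g', g)  for each arrow g' -> g,

    and everything else vanishes, except in types 1i1 and 2i11. So
    r (c_g - \sum eps c_g') = 0, and r can be cancelled. In types 1i1 and 2i11
    the coefficient of a_g in T a_g is q - r - 1 and T also exchanges a_g with
    a_x, for x = w_kappa x g. The arrows into g and into x start from the same
    parameter, so subtracting the equation for x from the one for g yields
    (q + 1) (c_g - c_x) = 0; hence c_g = c_x and the extra terms cancel.

    Three facts underlie the table of coefficients.
    - In types 1r2 and 2r22 the term a_{w_kappa x h} of T a_h is never an ascent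
      (r22_kcross), and in types 1i1 and 2i11 it is the other value of the
      inverse Cayley transform (i11_kcross). Both come from the quadratic relation
      (T + 1) (T - q) = 0 evaluated at a single well-chosen coordinate, which
      avoids any study of w_kappa and of iterated Cayley transforms.
    - The weights are nonzero (weight_neq0). For the types of defect 1 the weight
      is u ^ l(kappa) - u, so this requires l(kappa) > 1: two distinct simple
      reflections have a product of length at least 2 (ell_gt1). The other types
      only require l(kappa) > 0.
    - Z[v, v^-1] is a domain, and nonvanishing of a polynomial in v can be checked
      by specializing at v = 2 (ev_neq0). *)

Local Notation u := (vX 1 ^+ 2).

(** * Nonzero Laurent polynomials *)

Set Implicit Arguments.
Unset Strict Implicit.

Lemma ev_neq0 (p : {poly int}) : p.[2] != 0 -> ev (vX 1) p != 0.
Proof.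
apply: contraNneq => /(congr1 val); rewrite ev_val rmorph0 => /eqP.
by rewrite tofrac_eq0 => /eqP->; rewrite horner0.
Qed.

Lemma laurent_mulf_eq0 (x y : laurent) : x != 0 -> x * y = 0 -> y = 0.
Proof.
have val_eq0 (z : laurent) : (val z == 0) = (z == 0).
  by rewrite -(inj_eq val_inj) (rmorph0 val).
move=> nz_x /(congr1 val); rewrite (rmorphM val) (rmorph0 val) => /eqP.
by rewrite mulf_eq0 !val_eq0 (negPf nz_x) => /eqP.
Qed.

Lemma uX_ev l : u ^+ l = ev (vX 1) ('X ^+ 2 ^+ l).
Proof. by rewrite !rmorphXn /= evX. Qed.

Lemma horner_X2l l : ('X ^+ 2 ^+ l : {poly int}).[2] = 4 ^+ l.
Proof. by rewrite !hornerE. Qed.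

Lemma exp4_gt0 l : 1 <= 4 ^+ l :> int.
Proof. by rewrite exprn_ege1. Qed.

Lemma laurent_nat_neq0 n : n.+1%:R != 0 :> laurent.
Proof.
have -> : n.+1%:R = ev (vX 1) n.+1%:R by rewrite rmorph_nat.
by apply: ev_neq0; rewrite -polyC_natr hornerC pnatr_eq0.
Qed.

Lemma uX_neq0 l : u ^+ l != 0.
Proof. by rewrite uX_ev; apply: ev_neq0; rewrite horner_X2l; have := exp4_gt0 l; lia. Qed.

Lemma uX_add1_neq0 l : u ^+ l + 1 != 0.
Proof.
have -> : u ^+ l + 1 = ev (vX 1) ('X ^+ 2 ^+ l + 1) by rewrite uX_ev rmorphD rmorph1.
by apply: ev_neq0; rewrite hornerD hornerC horner_X2l; have := exp4_gt0 l; lia.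
Qed.

(** At v = 2 the left-hand side is at least u ^ l - 1 > 0. *)
Lemma uX_sub1_natr_neq0 a b l : (0 < l)%N -> (u ^+ l - 1) * a.+1%:R + b%:R != 0.
Proof.
case: l => // l _.
have -> : (u ^+ l.+1 - 1) * a.+1%:R + b%:R =
  ev (vX 1) (('X ^+ 2 ^+ l.+1 - 1) * a.+1%:R + b%:R).
  by rewrite uX_ev rmorphD rmorphM rmorphB rmorph1 !rmorph_nat.
apply: ev_neq0; rewrite -!polyC_natr hornerD hornerM hornerD hornerN !hornerC horner_X2l.
by rewrite exprS; have := exp4_gt0 l; nia.
Qed.

Lemma uX_sub1_neq0 l : (0 < l)%N -> u ^+ l - 1 != 0.
Proof. by move/(uX_sub1_natr_neq0 0 0); rewrite addr0 mulr1. Qed.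

Lemma uX_subu_neq0 l : (1 < l)%N -> u ^+ l - u != 0.
Proof.
case: l => [|[|l]] // _.
have -> : u ^+ l.+2 - u = ev (vX 1) ('X ^+ 2 ^+ l.+2 - 'X ^+ 2 ^+ 1).
  by rewrite -[X in _ - X]expr1 !uX_ev rmorphB.
apply: ev_neq0; rewrite hornerD hornerN !horner_X2l !exprS expr0.
by have := exp4_gt0 l; lia.
Qed.

(** * The length of w_kappa *)

Section Length.
Variables (R : basedRootDatum) (sg : diagramTwist R).
Implicit Types a b c : rdroot R.

(** The roots b and c may coincide: linear independence is applied to the family
    that adds up the coefficients. *)
Lemma simple_lindep a b c (x y z : int) : a \in simples R -> b \in simples R ->
  c \in simples R -> a != b -> a != c ->
  x *: wt a + y *: wt b + z *: wt c = 0 -> x = 0.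
Proof.
move=> Sa Sb Sc ab ac E.
have := simple_indep (c := fun d => x *+ (d == a) + y *+ (d == b) + z *+ (d == c)).
have S1 d w : d \in simples R -> \sum_(e in simples R) (w *+ (e == d)) *: wt e = w *: wt d.
  move=> Sd; rewrite (bigD1 d) //= eqxx big1 ?addr0 // => e /andP[_ /negPf->].
  by rewrite scale0r.
under eq_bigr do rewrite !scalerDl.
rewrite !big_split /= !S1 // => /(_ E a Sa).
by rewrite eqxx (negPf ab) (negPf ac) !addr0.
Qed.

Lemma negr_wt a : wt (negr a) = - wt a.
Proof.
by rewrite /negr refl_wt pairing_diag scaler_nat mulr2n opprD addrA subrr sub0r.
Qed.

Lemma refl_neq1 a : refl a != 1%g.
Proof.
apply/eqP => E; have := pairing_diag a.
rewrite /pairing -{1}[a](perm1 a) -E -/(negr a) negr_wt mulNmx mxE -/(pairing a a).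
by rewrite pairing_diag.
Qed.

Lemma wt_refl2 a b : wt (refl b (refl a a)) = - wt a + pairing a b *: wt b.
Proof.
have P : pairing (refl a a) b = - pairing a b.
  by rewrite /pairing -/(negr a) negr_wt mulNmx mxE.
by rewrite refl_wt P -/(negr a) negr_wt scaleNr opprK.
Qed.

Lemma refl_mul_neq1 a b : a \in simples R -> b \in simples R -> a != b ->
  (refl a * refl b)%g != 1%g.
Proof.
move=> Sa Sb ab; apply/eqP => /permP/(_ a); rewrite permM perm1 => /(congr1 (@wt R)).
rewrite wt_refl2 => /eqP; rewrite -subr_eq0 => /eqP E.
have := @simple_lindep a b b (-2) (pairing a b) 0 Sa Sb Sb ab ab.
rewrite scale0r addr0 => H; suff: (-2 : int) = 0 by [].
by apply: H; rewrite -E scaleNr scaler_nat mulr2n opprD -!addrA; congr (_ + _); rewrite addrC.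
Qed.

(** Evaluating an equality s_b s_a = s_c at a would express 2 a through the
    simple roots b and c, unless c = a, where it would give s_b = 1. *)
Lemma refl_mul_neq_refl a b c : a \in simples R -> b \in simples R ->
  c \in simples R -> a != b -> (refl a * refl b)%g != refl c.
Proof.
move=> Sa Sb Sc ab; apply/eqP => E.
have [Ea|ca] := eqVneq c a.
  move/eqP: E; rewrite Ea -{2}[refl a]mulg1 (inj_eq (mulgI _)).
  exact/negP/refl_neq1.
move/permP/(_ a): E; rewrite permM => /(congr1 (@wt R)).
rewrite wt_refl2 refl_wt => /eqP; rewrite -subr_eq0 => /eqP E.
suff: (-2 : int) = 0 by [].
apply: (@simple_lindep a b c (-2) (pairing a b) (pairing a c)) => //.
  by rewrite eq_sym.
rewrite -E opprB scaleNr scaler_nat mulr2n opprD addrA [RHS]addrAC.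
by congr (_ + _); rewrite [RHS]addrAC.
Qed.

Lemma wlen_le_wk (k : {set rdroot R}) w :
  w \in <<[set refl a | a in k]>>%g -> (wlen w <= ell k)%N.
Proof.
move=> Gw; rewrite /ell /wk; case: arg_maxnP => [|v _]; first exact: group1.
exact.
Qed.

Lemma weyl_refl a : a \in simples R -> refl a \in weyl R.
Proof. by move=> Sa; apply/mem_gen/imset_f. Qed.

Lemma card_weyl_gt1 a : a \in simples R -> (1 < #|weyl R|)%N.
Proof.
move=> Sa; rewrite cardG_gt1; apply/trivgPn; exists (refl a); first exact: weyl_refl.
exact: refl_neq1.
Qed.

(** The length is searched below #|W| only; a simple root makes W nontrivial, so
    that the search does not stop too early. *)
Lemma wlen_gt0 a (w : {perm rdroot R}) : a \in simples R -> w != 1%g -> (0 < wlen w)%N.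
Proof.
move=> /card_weyl_gt1 W1 w1; rewrite /wlen; case: #|weyl R| W1 => // n _ /=.
by rewrite expg0 inE (negPf w1).
Qed.

Lemma wlen_gt1 a (w : {perm rdroot R}) : a \in simples R -> w != 1%g ->
  w \notin [set refl b | b in simples R] -> (1 < wlen w)%N.
Proof.
move=> /card_weyl_gt1 W1 w1 wS; rewrite /wlen; case: #|weyl R| W1 => [|[|n]] // _ /=.
by rewrite expg0 inE (negPf w1) expg1 (negPf wS).
Qed.

Lemma ell_gt0 k : k \in Sbar sg -> (0 < ell k)%N.
Proof.
case/imsetP=> a Sa ->; apply: leq_trans (wlen_le_wk (w := refl a) _).
  by apply: wlen_gt0 Sa (refl_neq1 a).
by apply/mem_gen/imset_f; rewrite set21.
Qed.

Lemma ell_gt1 k a : k \in Sbar sg -> a \in k -> sg a != a -> (1 < ell k)%N.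
Proof.
move=> /imsetP[b Sb ->] Hab saNa.
have ab : b != sg b.
  by move: Hab saNa; rewrite !inE => /orP[]/eqP-> //; rewrite ?sigmaK // eq_sym.
have Ssb : sg b \in simples R by apply: sigma_simple.
apply: leq_trans (wlen_le_wk (w := (refl b * refl (sg b))%g) _).
  apply: (wlen_gt1 Sb); first exact: refl_mul_neq1.
  by apply/imsetP => -[c Sc]; apply/eqP/refl_mul_neq_refl.
by apply: groupM; apply/mem_gen/imset_f; rewrite !inE eqxx ?orbT.
Qed.
End Length.

(** * The Hecke operator on the basis of parameters *)

Definition ring_simp {A : nzRingType} := (@mulr0n A, @mulr1n A, @mulr0 A, @mul0r A,
  @mulr1 A, @mul1r A, @add0r A, @addr0 A, @subr0 A, @subrr A, @oppr0 A, @subKr A).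

(** The rows of T at the two parameters exchanged in type 1i1 or 2i11: x and y
    are their coordinates in an eigenvector, s the common sum over arrows. *)
Lemma exchanged_rows (A : comNzRingType) (q s x y : A) :
  (q - 1) * x + x = (q - 1) * s + y -> (q - 1) * y + y = (q - 1) * s + x ->
  (q + 1) * (x - y) = 0.
Proof.
move=> E1 E2.
have -> : (q + 1) * (x - y) =
    ((q - 1) * x + x - ((q - 1) * s + y))
    - ((q - 1) * y + y - ((q - 1) * s + x)) by ring.
by rewrite E1 E2 !subrr.
Qed.

Section Hecke.
Variables (R : basedRootDatum) (sg : diagramTwist R) (L : lvParam sg).
Hypothesis hL : cayleyFacts L.
Variables (N : lvModule L) (k : {set rdroot R}).
Hypothesis kS : k \in Sbar sg.
Implicit Types g h x y z : Dsig L.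

Local Notation q := (u ^+ ell k : laurent).
Local Notation T := (Tk N k).
Local Notation ty g := (ltype g k).
Local Notation e g := (avec (val g)).

Lemma lvDE (f f' : lvmod L) g : (f + f') g = f g + f' g :> laurent.
Proof. by rewrite ffunE. Qed.
Lemma lvNE (f : lvmod L) g : (- f) g = - f g :> laurent.
Proof. by rewrite ffunE. Qed.
Lemma lvZE (c : laurent) (f : lvmod L) g : (c *: f) g = c * f g :> laurent.
Proof. by rewrite ffunE. Qed.
Lemma avecE (x : par L) g : avec x g = (val g == x)%:R :> laurent.
Proof. by rewrite ffunE. Qed.

Lemma sum_avecE (X : {set Dsig L}) (c : Dsig L -> laurent) g :
  (\sum_(h in X) c h *: e h) g = (if g \in X then c g else 0) :> laurent.
Proof.
rewrite sum_ffunE; under eq_bigr => h _ do rewrite lvZE avecE (inj_eq val_inj).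
case: ifP => Xg; last first.
  apply: big1 => h Xh; case: eqP => [E|_]; last by rewrite mulr0.
  by rewrite E Xh in Xg.
rewrite (bigD1 g) //= eqxx mulr1 big1 ?addr0 // => h /andP[_ hg].
by rewrite eq_sym (negPf hg) mulr0.
Qed.

Lemma sum1_avecE (X : {set Dsig L}) g :
  (\sum_(h in X) e h) g = (g \in X)%:R :> laurent.
Proof.
under eq_bigr do rewrite -[avec _]scale1r.
by rewrite (sum_avecE X (fun=> 1)); case: ifP.
Qed.

Definition lvE := (lvDE, lvNE, lvZE, avecE, sum_avecE, sum1_avecE).

Lemma tauE g : (k \in tau g) = is_descent (ty g).
Proof. by rewrite inE kS. Qed.

Lemma kup_ascent g h : h \in kup g k -> ~~ is_descent (ty g) /\ is_descent (ty h).
Proof. by move/(kup_type hL kS); case: (ty g) => //; case: (ty h). Qed.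

Lemma kup_ascentF g h : ~~ is_descent (ty h) -> (h \in kup g k) = false.
Proof. by move=> /negPf dh; apply/negP => /kup_ascent[_]; rewrite dh. Qed.

Definition is_cm (t : lvtype) : bool :=
  match t with T1Cm | T2Cm | T3Cm => true | _ => false end.
Definition is_i11 (t : lvtype) : bool :=
  match t with T1i1 | T2i11 => true | _ => false end.
Definition is_r22 (t : lvtype) : bool :=
  match t with T1r2 | T2r22 => true | _ => false end.

(** In these types parameters come in pairs with a common transform; i11_kcross
    identifies the partner as w_kappa x g. *)
Lemma i11_block g : is_i11 (ty g) -> exists h g',
  [/\ kup g k = [set h], kdn h k = [set g; g'], g' != g, is_i11 (ty g')
    & kup g' k = [set h]].
Proof.
move=> tg; have ag : k \notin tau g by rewrite tauE; case: (ty g) tg.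
have /eqP/cards1P[h Eh] : #|kup g k| = 1%N.
  by rewrite (kup_card hL) //; case: (ty g) tg.
have hg : h \in kup g k by rewrite Eh set11.
have dh : #|kdn h k| = 2%N.
  rewrite (kdn_card hL) // ?tauE; last by case: (kup_ascent hg).
  by have := kup_type hL kS hg; case: (ty g) tg => // _; case: (ty h).
have {dh} [g' gg' Eg] : exists2 g', g' != g & kdn h k = [set g; g'].
  have gh : g \in kdn h k by rewrite -(kup_kdn hL).
  move/eqP/cards2P: dh gh => [x [y [xy ->]]]; rewrite !inE => /orP[]/eqP->.
    by exists y => //; rewrite eq_sym.
  by exists x => //; rewrite setUC.
have g'h : h \in kup g' k by rewrite (kup_kdn hL) // Eg set22.
have tg' : is_i11 (ty g').
  have := kup_type hL kS g'h; have := kup_type hL kS hg.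
  by case: (ty g) tg => // _; case: (ty h) => // _; case: (ty g').
exists h, g'; split=> //; apply/eqP; rewrite eq_sym eqEcard sub1set g'h cards1.
rewrite (kup_card hL) //; first by case: (ty g') tg'.
by rewrite tauE; case: (ty g') tg'.
Qed.

Lemma r22_block g : is_r22 (ty g) -> exists h g',
  [/\ kdn g k = [set h], kup h k = [set g; g'] & g' != g].
Proof.
move=> tg; have dg : k \in tau g by rewrite tauE; case: (ty g) tg.
have /eqP/cards1P[h Eh] : #|kdn g k| = 1%N.
  by rewrite (kdn_card hL) //; case: (ty g) tg.
have gh : g \in kup h k by rewrite (kup_kdn hL) // Eh set11.
have ch : #|kup h k| = 2%N.
  rewrite (kup_card hL) // ?tauE; last by case: (kup_ascent gh).
  by have := kup_type hL kS gh; case: (ty g) tg => // _; case: (ty h).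
move/eqP/cards2P: ch (gh) => [x [y [xy Exy]]]; rewrite Exy !inE => gxy.
exists h; case/orP: gxy => /eqP Eg; subst g; first by exists y; rewrite eq_sym.
by exists x; rewrite Exy setUC.
Qed.

Lemma avec_out (x : par L) : (forall g, val g != x) -> avec x = 0.
Proof. by move=> H; apply/ffunP => g; rewrite !ffunE (negPf (H g)). Qed.

Lemma Tk2 (f : lvmod L) : T (T f) = (q - 1) *: T f + q *: f.
Proof.
have := Tk_quadratic N f kS; rewrite linearB linearZ /= => E.
apply/eqP; rewrite -subr_eq0 -E scalerBl scale1r; apply/eqP.
by rewrite !opprD !opprK !addrA.
Qed.

(** Up-transforms of g that have type 1r2 or 2r22 force g to have type 1i2f or
    2i22, whose formula has coefficients 0 and 1; the formulas with negative
    coefficients or u + 1 do not reach such an h. *)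
Lemma ascent_r22_coef g h : ~~ is_descent (ty g) -> is_r22 (ty h) ->
  exists n, T (e g) h = n%:R :> laurent.
Proof.
move=> ag th.
have hg : (val h == val g) = false.
  by apply/eqP => /val_inj E; move: ag th; rewrite E; case: (ty g).
rewrite TkE // /hecke_formula; have [hk|/negPf hk] := boolP (h \in kup g k).
  have := kup_type hL kS hk; case: (ty g) ag => // _; case: (ty h) th => // _ _.
    by exists 1%N; rewrite !lvE hg hk add0r.
  by exists 1%N; rewrite !lvE hg hk add0r.
case: (ty g) ag => // _; rewrite !lvE ?hg ?hk ?mulr0 ?addr0 ?oppr0;
  by [exists 0%N | eexists].
Qed.

(** Suppose that the term - a_{w_kappa x h} of T a_h were - a_g. Comparing
    coefficients of a_h in T (T a_h) = (q - 1) T a_h + q a_h, the coefficient of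
    a_h in T a_g would have to be -1, whereas it is a natural number. *)
Lemma r22_kcross g h : is_r22 (ty h) -> ~~ is_descent (ty g) ->
  (val g == kcross h k) = false.
Proof.
move=> th ag; apply/negP => /eqP Eg.
have [d [z [Ed Ez zh]]] := r22_block th.
have [n En] := ascent_r22_coef ag th.
have hd : h \in kup d k by rewrite Ez set21.
have [ad _] := kup_ascent hd.
have neq x : ~~ is_descent (ty x) -> (val h == val x) = false.
  move=> ax; apply/eqP => /val_inj E; move: ax th; rewrite E; case: (ty x) => //.
have Th : T (e h) = (q - 1) *: e h - e g + (q - 1) *: e d.
  rewrite TkE // /hecke_formula -Eg Ed big_set1.
  by case: (ty h) th.
have hdF := neq d ad; have hgF := neq g ag.
have Td : T (e d) h = 1 :> laurent.
  rewrite TkE // /hecke_formula; have := kup_type hL kS hd.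
  case: (ty d) ad => // _; case: (ty h) th => // _ _;
  by rewrite !lvE hdF hd add0r.
have := congr1 (fun f : lvmod L => f h : laurent) (Tk2 (e h)).
rewrite {1}Th linearD linearB !linearZ /= Th !lvE En Td hdF hgF eqxx.
rewrite !ring_simp -addrA => /addrI E.
suff : n.+1%:R = 0 :> laurent by apply/eqP/laurent_nat_neq0.
have {}E : q - (n%:R + 1) = q - 0 by rewrite subr0 -[RHS]E opprD addrCA.
by rewrite -natr1; move/addrI/oppr_inj: E.
Qed.

(** q minus the coefficient of a_g in T a_g, for g an ascent of type t, up to the
    correction of Tk_coef in types 1i1 and 2i11. *)
Definition weight (t : lvtype) : laurent :=
  match t with
  | T1Cp | T2Cp | T3Cp => q
  | T1i1 | T1i2f | T2i11 | T2i12 | T2i22 => q - 1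
  | T2Ci | T3Ci | T3i => q - u
  | _ => q + 1
  end.

(** The arrows h -> g into an ascent g, read off the types instead of the
    coefficients of T; see arrowE. *)
Definition down_to h g : bool :=
  (h \in kup g k) || is_cm (ty h) && (val g == kcross h k).

Definition is_cp (t : lvtype) : bool :=
  match t with T1Cp | T2Cp | T3Cp => true | _ => false end.

Lemma kcrossF g h : ~~ is_descent (ty g) -> is_cp (ty h) || is_r22 (ty h) ->
  (val g == kcross h k) = false.
Proof.
move=> ag /orP[th|/r22_kcross-> //]; apply/negP => /eqP Eg.
have := kcross_Cp hL h kS.
by case: (ty h) th => // _ [x]; rewrite -Eg => /val_inj-> E; rewrite E in ag.
Qed.

Lemma cm_kcross g h : is_cm (ty h) -> val g = kcross h k -> is_cp (ty g).
Proof.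
move=> th Eg; have := kcross_Cp hL h kS.
by case: (ty h) th => // _ [x]; rewrite -Eg => /val_inj-> ->.
Qed.

Lemma Tk_coef_diag g : ~~ is_descent (ty g) ->
  T (e g) g = q - weight (ty g) - (is_i11 (ty g))%:R
    + (is_i11 (ty g) && (val g == kcross g k))%:R :> laurent.
Proof.
move=> ag; have kF : (g \in kup g k) = false by exact: kup_ascentF.
have crF := kcrossF (h := g) ag.
rewrite TkE // /hecke_formula; case: (ty g) ag crF => // _ crF.
(* The vanishing of the w_kappa x h term is kept in the types that it covers. *)
all: first [move/(_ isT): crF => crF | clear crF].
all: by rewrite !lvE ?kF ?crF ?eqxx //= ?ring_simp ?opprD ?addrA ?ring_simp.
Qed.

Lemma Tk_coef_kdn h g : g \in kdn h k ->
  T (e h) g = weight (ty g) * eps (second N) k h g :> laurent.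
Proof.
move=> gh; have hg : h \in kup g k by rewrite (kup_kdn hL).
have [ag dh] := kup_ascent hg.
have crF := kcrossF (h := h) ag.
have vghF : (val g == val h) = false.
  by apply/eqP => /val_inj E; rewrite -E (negPf ag) in dh.
rewrite TkE // /hecke_formula /eps; have := kup_type hL kS hg.
case: (ty g) ag => // _; case: (ty h) crF {dh} => crF //= _.
all: first [move/(_ isT): crF => crF | clear crF].
all: by rewrite !lvE ?gh vghF ?crF //= ?ring_simp.
Qed.

Lemma Tk_coef_off h g : ~~ is_descent (ty g) -> g != h -> g \notin kdn h k ->
  T (e h) g = (is_cm (ty h) && (val g == kcross h k))%:R * q
    + (is_i11 (ty h) && (val g == kcross h k))%:R :> laurent.
Proof.
move=> ag gh /negPf ghN; have kF : (g \in kup h k) = false by exact: kup_ascentF.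
have crF := kcrossF (h := h) ag.
have vghF : (val g == val h) = false by rewrite (inj_eq val_inj) (negPf gh).
rewrite TkE // /hecke_formula; case: (ty h) crF => crF.
all: first [move/(_ isT): crF => crF | clear crF].
all: rewrite !lvE ?vghF ?kF ?ghN ?crF //= ?ring_simp //.
all: by rewrite mulrC.
Qed.

(** One formula for all types of ascents, so that the eigenvector equation can be
    solved once; the last term is the exchange of a_g and its partner in types
    1i1 and 2i11. *)
Lemma Tk_coef h g : ~~ is_descent (ty g) ->
  T (e h) g = (g == h)%:R * (q - weight (ty g) - (is_i11 (ty g))%:R)
    + (if down_to h g then weight (ty g) * eps (second N) k h g else 0)
    + (is_i11 (ty h) && (val g == kcross h k))%:R :> laurent.
Proof.
move=> ag; rewrite /down_to.
have [<-|gh] := eqVneq g h.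
  rewrite kup_ascentF // Tk_coef_diag //.
  have -> : is_cm (ty g) = false by case: (ty g) ag.
  by rewrite mul1r addr0.
rewrite mul0r add0r (kup_kdn hL) //.
have [ghk|ghk] := boolP (g \in kdn h k).
  rewrite Tk_coef_kdn //=.
  have -> : is_i11 (ty h) = false.
    by move: ghk; rewrite -(kup_kdn hL) // => /kup_ascent[_]; case: (ty h).
  by rewrite addr0.
rewrite Tk_coef_off //=; congr (_ + _).
case: andP => [[ch /eqP Eg]|_]; last by rewrite mul0r.
rewrite mul1r /eps; have := cm_kcross ch Eg.
by case: (ty g) => // _; case: (ty h) ch => // _; rewrite mulr1.
Qed.

(** Defect 1 only occurs when kappa has two elements. *)
Lemma defect_ell g : defect g k != 0%N -> (1 < ell k)%N.
Proof.
rewrite /defect /ltype; case: pickP => [a ak|_] //=.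
have [sga|/(ell_gt1 kS ak)//] := eqVneq (sg a) a.
by rewrite /type_at sga eqxx; do ![case: ifP => _].
Qed.

(** Case analysis on the weight with P abstract, so that the 30 cases are settled
    without computing in the fraction field. *)
Lemma weight_ind (P : laurent -> Prop) t :
  P q -> P (q - 1) -> P (q + 1) -> (tdefect t != 0%N -> P (q - u)) -> P (weight t).
Proof. by move=> Pq Pm Pp Pu; case: t Pu => Pu //; apply: Pu. Qed.

Lemma weight_neq0 g : weight (ty g) != 0.
Proof.
refine (@weight_ind (fun x : laurent => x != 0) (ty g) (uX_neq0 _)
  (uX_sub1_neq0 (ell_gt0 kS)) (uX_add1_neq0 _) _).
by move/defect_ell/uX_subu_neq0.
Qed.

Lemma eps_neq0 h g : eps (second N) k h g != 0.
Proof.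
rewrite /eps; case: (ty h); rewrite ?oner_eq0 //.
by case: (_ && _); rewrite ?expr0 ?expr1 ?oppr_eq0 oner_eq0.
Qed.

Lemma down_to_descent h g : ~~ is_descent (ty g) -> down_to h g -> is_descent (ty h).
Proof.
move=> ag /orP[/kup_ascent[]//|/andP[ch _]].
by case: (ty h) ch.
Qed.

Lemma arrowE h g : ~~ is_descent (ty g) -> arrow (Tk N) k h g = down_to h g.
Proof.
move=> ag; rewrite /arrow !tauE ag andTb.
have [dh|nh] := boolP (is_descent (ty h)); last first.
  by apply/esym/negP => /(down_to_descent ag); rewrite (negPf nh).
have ghF : (g == h) = false by apply/eqP => E; rewrite E dh in ag.
have ih : is_i11 (ty h) = false by case: (ty h) dh.
rewrite Tk_coef // ghF ih mul0r add0r addr0.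
case: ifP => _; last by rewrite eqxx.
apply/eqP => E; case/eqP: (eps_neq0 h g).
exact: laurent_mulf_eq0 (weight_neq0 g) E.
Qed.

(** In the quadratic relation at a_g take the coefficient of a_g'. If
    w_kappa x g were not g', it would say that the coefficient of a_g' in
    T a_{w_kappa x g} is 1 - q; but all entries in the row of g' outside the
    diagonal have the form (q - 1) n + b with natural n and b. *)
Lemma i11_kcross g h g' : is_i11 (ty g) -> is_i11 (ty g') -> g' != g ->
  kup g k = [set h] -> kdn h k = [set g; g'] -> val g' = kcross g k.
Proof.
move=> tg tg' g'g Eup Edn.
have ag' : ~~ is_descent (ty g') by case: (ty g') tg'.
have g'h : g' \in kdn h k by rewrite Edn set22.
have hg' : h \in kup g' k by rewrite (kup_kdn hL).
have g'hF : (val g' == val h) = false.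
  apply/eqP => /val_inj E; have [_] := kup_ascent hg'.
  by rewrite -E (negPf ag').
have q1 := uX_sub1_natr_neq0 _ _ (ell_gt0 kS).
have w1 : weight (ty g') = q - 1 by case: (ty g') tg'.
have Tg : T (e g) = avec (kcross g k) + e h.
  by rewrite TkE // /hecke_formula Eup big_set1; case: (ty g) tg.
have Th : T (e h) g' = q - 1 :> laurent.
  rewrite Tk_coef_kdn // w1 /eps; have := kup_type hL kS hg'.
  by case: (ty g') tg' => // _; case: (ty h) => // _; rewrite mulr1.
have := congr1 (fun f : lvmod L => f g' : laurent) (Tk2 (e g)).
rewrite {1}Tg linearD /= Tg !lvE Th g'hF (inj_eq val_inj) (negPf g'g).
(* If w_kappa x g is not g', its basis vector has coordinate 0 at g'. *)
rewrite !ring_simp; case: eqP => // nE.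
rewrite !ring_simp => E; exfalso.
suff [n [b Tn]] : exists n b, T (avec (kcross g k)) g' = (q - 1) * n%:R + b%:R :> laurent.
  case/eqP: (q1 n b); rewrite -[RHS]E Tn -natr1 mulrDr mulr1.
  by rewrite addrAC.
(* Outside the sigma-fixed parameters the basis vector of w_kappa x g is 0. *)
have [x Ex|out] := pickP (fun x => val x == kcross g k); last first.
  exists 0%N, 0%N; rewrite avec_out ?linear0 ?ffunE ?mulr0 ?addr0 //.
  by move=> x; rewrite out.
have g'x : (g' == x) = false by apply/eqP => E'; apply: nE; rewrite E'; apply/eqP.
rewrite -(eqP Ex) Tk_coef // g'x w1 mul0r add0r.
(* n and b indicate an arrow x -> g' and an exchange of x with g'. *)
exists (down_to x g'); eexists; congr (_ + _).
case: ifP => [dx|_]; last by rewrite mulr0.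
congr (_ * _); rewrite /eps; case/orP: dx => [/(kup_type hL kS)|/andP[cx _]].
  by case: (ty g') tg' => // _; case: (ty x).
by case: (ty x) cx.
Qed.

Lemma lv_sumE (F : Dsig L -> lvmod L) g :
  (\sum_h F h) g = \sum_h (F h g : laurent) :> laurent.
Proof. by rewrite sum_ffunE. Qed.

Lemma kcross_inj x y : kcross x k = kcross y k -> x = y.
Proof. by rewrite /kcross => /act_inj/val_inj. Qed.

Lemma lvmod_sum (c : lvmod L) : c = \sum_h (c h : laurent) *: e h.
Proof.
apply/ffunP => g; have := sum_avecE [set: Dsig L] (fun h => c h : laurent) g.
rewrite in_setT => {1}<-; congr (fun_of_fin _ g).
by apply: eq_bigl => h; rewrite in_setT.
Qed.

(** * Coordinates of eigenvectors *)
Section Eigen.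
Variable c : lvmod L.
Hypothesis Tc : T c = q *: c.

Lemma eigen_row g : ~~ is_descent (ty g) ->
  weight (ty g) * c g + (is_i11 (ty g))%:R * c g =
  weight (ty g) * (\sum_(h | down_to h g) eps (second N) k h g * c h)
  + \sum_(h | is_i11 (ty h) && (val g == kcross h k)) c h :> laurent.
Proof.
move=> ag; have := congr1 (fun f : lvmod L => f g : laurent) Tc.
rewrite /= lvZE {1}(lvmod_sum c) linear_sum lv_sumE /=.
under eq_bigr do rewrite linearZ lvZE Tk_coef // mulrDr mulrDr.
rewrite !big_split /=.
set w := weight (ty g); set i := (is_i11 (ty g))%:R.
have -> : \sum_h c h * ((g == h)%:R * (q - w - i)) = c g * (q - w - i) :> laurent.
  rewrite (bigD1 g) //= eqxx mul1r big1 ?addr0 // => h; rewrite eq_sym => /negPf->.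
  by rewrite mul0r mulr0.
have -> : \sum_h c h * (if down_to h g then w * eps (second N) k h g else 0) =
    w * (\sum_(h | down_to h g) eps (second N) k h g * c h) :> laurent.
  rewrite mulr_sumr [RHS]big_mkcond /=; apply: eq_bigr => h _.
  by case: ifP => _; rewrite ?mulr0 // mulrC mulrA.
have -> : \sum_h c h * (is_i11 (ty h) && (val g == kcross h k))%:R =
    \sum_(h | is_i11 (ty h) && (val g == kcross h k)) c h :> laurent.
  rewrite [RHS]big_mkcond /=; apply: eq_bigr => h _.
  by case: ifP => _; rewrite ?mulr0 ?mulr1.
move: (\sum_(h | _) _) (\sum_(h | _ && _) _) => x y E.
have -> : w * x + y = q * c g - c g * (q - w - i).
  by rewrite -E -[in RHS]addrA [RHS]addrC addKr.
by rewrite [c g * _]mulrC -mulrBl -[q - w - i]addrA -opprD subKr mulrDl.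
Qed.

Lemma i11_weight g : is_i11 (ty g) -> weight (ty g) = q - 1.
Proof. by case: (ty g). Qed.

Lemma down_to_i11 g h : is_i11 (ty g) -> down_to h g = (h \in kup g k).
Proof.
move=> ig; rewrite /down_to; case: andP => [[ch /eqP/(cm_kcross ch)]|_].
  by case: (ty g) ig.
by rewrite orbF.
Qed.

Lemma i11_partner g : is_i11 (ty g) -> exists g',
  [/\ is_i11 (ty g'), kup g' k = kup g k, val g' = kcross g k & val g = kcross g' k].
Proof.
move=> ig; have [h [g' [Eup Edn g'g ig' Eup']]] := i11_block ig.
exists g'; split=> //; first by rewrite Eup' Eup.
  exact: i11_kcross ig ig' g'g Eup Edn.
apply: (i11_kcross ig' ig _ Eup'); first by rewrite eq_sym.
by rewrite Edn setUC.
Qed.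

(** The weight is cancelled from eigen_row. In types 1i1 and 2i11 the rows of g
    and of its partner are compared first, since each contains the other
    coordinate. *)
Lemma eigen_descent g : ~~ is_descent (ty g) ->
  c g = \sum_(h | down_to h g) eps (second N) k h g * c h :> laurent.
Proof.
move=> ag; pose S x : laurent := \sum_(h | down_to h x) eps (second N) k h x * c h.
have [ig|nig] := boolP (is_i11 (ty g)); last first.
  have := eigen_row ag; rewrite (negPf nig) mul0r addr0 [X in _ + X]big_pred0.
    rewrite addr0 => E; apply/eqP; rewrite -subr_eq0; apply/eqP.
    by apply: (laurent_mulf_eq0 (weight_neq0 g)); rewrite mulrBr E subrr.
  move=> h; apply/negP => /andP[ih /eqP Eg].
  have [h' [ih' _ Eh' _]] := i11_partner ih.
  by rewrite -Eg in Eh'; rewrite (val_inj Eh') (negPf nig) in ih'.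
have row x y : is_i11 (ty x) -> val x = kcross y k -> is_i11 (ty y) ->
    (q - 1) * c x + c x = (q - 1) * S x + c y :> laurent.
  move=> ix Ex iy; have ax : ~~ is_descent (ty x) by case: (ty x) ix.
  have := eigen_row ax; rewrite ix mul1r i11_weight // => ->; congr (_ + _).
  apply: big_pred1 => h /=.
  apply/idP/eqP => [/andP[_ /eqP Eh]|->]; last by rewrite iy Ex eqxx.
  by apply: kcross_inj; rewrite -Eh.
have [g' [ig' Eup Eg' Eg]] := i11_partner ig.
have SS : S g' = S g.
  apply: eq_big => [h|h]; first by rewrite !down_to_i11 // Eup.
  rewrite down_to_i11 // => hg'.
  rewrite /eps; have := kup_type hL kS hg'.
  by case: (ty g') ig' => // _; case: (ty h).
have r1 := row _ _ ig Eg ig'; have r2 := row _ _ ig' Eg' ig.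
rewrite SS in r2.
rewrite -/(S g); move: (S g) (c g : laurent) (c g' : laurent) r1 r2 => s x y r1 r2.
have xy : x = y.
  apply/eqP; rewrite -subr_eq0; apply/eqP.
  apply: (laurent_mulf_eq0 (uX_add1_neq0 (ell k))).
  exact: (@exchanged_rows laurent _ _ _ _ r1 r2).
move: r1; rewrite xy => /addIr E.
apply/eqP; rewrite -subr_eq0; apply/eqP.
by apply: (laurent_mulf_eq0 (uX_sub1_neq0 (ell_gt0 kS))); rewrite mulrBr E subrr.
Qed.
End Eigen.
End Hecke.

(** * Rescaling to the canonical basis *)

Lemma vX1_expr_ell l : (vX 1 ^+ 2) ^+ l = vX l%:Z * vX l%:Z.
Proof. by rewrite -exprM vXn mul1r mul2n -addnn PoszD vXD. Qed.

Lemma That_eigen (R : basedRootDatum) (sg : diagramTwist R) (L : lvParam sg)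
    (N : lvModule L) (k : {set rdroot R}) (x : lvmod L) :
  That N k x = (vX (ell k)%:Z + vX (- (ell k)%:Z)) *: x ->
  Tk N k x = (vX 1 ^+ 2) ^+ ell k *: x.
Proof.
move/(congr1 (fun y => vX (ell k)%:Z *: y)); rewrite /That !scalerA mulrDr -vXD subrr vX0.
by rewrite scale1r scalerDl scale1r vX1_expr_ell => /addIr.
Qed.

Lemma ChatE (R : basedRootDatum) (sg : diagramTwist R) (L : lvParam sg)
    (P : Dsig L -> Dsig L -> laurent) (d g : Dsig L) :
  Chat P d g = P g d * vX (- (len (val g))%:Z) :> laurent.
Proof.
have := sum_avecE [set: Dsig L] (fun h => P h d * vX (- (len (val h))%:Z)) g.
rewrite in_setT => <-; congr (fun_of_fin _ g).
by apply: eq_big => [h|h _]; rewrite ?in_setT // /ahat scalerA.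
Qed.

Unset Implicit Arguments.
Set Strict Implicit.

Theorem lemma10p1p1 (R : basedRootDatum) (sg : diagramTwist R)
    (L : lvParam sg) (hL : cayleyFacts L) (N : lvModule L)
    (B : canonicalBasis N) (k : {set rdroot R}) (g m : Dsig L) :
  k \in Sbar sg -> k \notin tau g -> k \in tau m ->
  Phat B g m =
    vX (- (ell k)%:Z + (defect g k)%:Z) *
    \sum_(g' : Dsig L | arrow (Tk N) k g' g) eps (second N) k g' g * Phat B g' m.
Proof.
move=> kS; rewrite tauE // => ag /(tau_Chat B _ kS)/That_eigen Tc.
have := eigen_descent hL kS Tc ag; rewrite ChatE => /(congr1 ( *%R^~ (vX (len (val g))%:Z))).
rewrite -mulrA -vXD addNr vX0 mulr1 => ->.
rewrite mulr_suml mulr_sumr; apply: eq_big => [h|h dh]; first by rewrite arrowE.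
have ar : arrow (Tk N) k h g by rewrite arrowE.
have -> : defect g k = defect h k by exact: arrow_defect ar.
have := arrow_len kS ar; rewrite ChatE => El.
have -> : - (ell k)%:Z + (defect h k)%:Z = - (len (val h))%:Z + (len (val g))%:Z.
  by apply: oppr_inj; rewrite !opprD !opprK El.
by rewrite vXD [RHS]mulrC !mulrA.
Qed.
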